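(* Let $G$ be a connected $c$-edge-colored multigraph on $n\ge 4$ vertices with $m$ edges, where $3\le c<n$. If $m\ge c\binom{n-1}{2}+n$, then $G$ has a proper Hamiltonian cycle.
   Context: A $c$-edge-colored multigraph has each edge colored with one color from $\{1,\dots,c\}$, and no two edges joining the same pair of vertices have the same color (no loops); $m$ counts all edges including parallel ones. Throughout, multigraphs are assumed connected. A proper Hamiltonian cycle is a cycle through all vertices in which any two consecutive edges have different colors. *)

(* Defs.v *)
From mathcomp Require Import all_boot.

Set Implicit Arguments.
Unset Strict Implicit.
Unset Printing Implicit Defensive.

(* An edge is a pair (e, k) of a two-element vertex set e and a colour k.
   Parallel edges differ by their colour; a colour may be unused. *)
Record ecmultigraph (V : finType) (c : nat) := ECMultigraph {
  edges : {set {set V} * 'I_c};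
  card_edge_ends : forall e : {set V} * 'I_c, e \in edges -> #|e.1| = 2
}.

Section ECMultigraphNotions.

Variables (V : finType) (c : nat).
Implicit Type G : ecmultigraph V c.

Definition adjacent G : rel V :=
  fun x y => [exists k : 'I_c, ([set x; y], k) \in edges G].

Definition connected G : Prop := forall x y : V, connect (adjacent G) x y.

(* The cycle runs through v_0, ..., v_(l-1), with an edge of colour k_i between
   v_i and v_(i+1); indices are taken mod l, ordS being the cyclic successor.
   The l edges are pairwise distinct: this follows from injectivity of v when
   l >= 3, and from k_0 != k_1 when l = 2. *)
Definition proper_cycle G (l : nat) (v : 'I_l -> V) (k : 'I_l -> 'I_c) : Prop :=
  [/\ 1 < l,
      injective v,
      forall i : 'I_l, ([set v i; v (ordS i)], k i) \in edges G
    & forall i : 'I_l, k i != k (ordS i)].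

Definition has_proper_hamiltonian_cycle G : Prop :=
  exists (l : nat) (v : 'I_l -> V) (k : 'I_l -> 'I_c),
    proper_cycle G v k /\ forall x : V, exists i : 'I_l, v i = x.

End ECMultigraphNotions.

(* Main.v *)
(** Let [missing x y] be the number of colours absent between [x] and [y]. Over
    unordered pairs these numbers add up to at most [(c-1)(n-1) - 1], and a
    random Hamiltonian cycle of the complete graph uses a given pair with
    probability [2/(n-1)], so some cycle misses at most [2c-3] colours. Hence at
    most one of its pairs has fewer than two colours, and some pair has at least
    three. If no pair is empty, colour greedily around the cycle, ending at a
    pair with three colours.
    If a pair [v_m v_0] is empty ([m = n-1]), the rest of the cycle misses at
    most [c-3] colours. The [n-3] disjoint couples of chords
    [{v_0 v_(i+1), v_m v_i}] miss at most [(c-1)(n-1) - 1 - c] colours in total,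
    which is less than [c(n-3)] because [c < n]; the 2-opt exchange along a
    couple missing fewer than [c] gives a cycle as in the first case. *)

Require Import Defs.
From mathcomp Require Import all_boot.
From mathcomp Require Import fingroup perm zmodp zify.

Set Implicit Arguments.
Unset Strict Implicit.
Unset Printing Implicit Defensive.

(** * Proper colourings from lists along paths and cycles *)

Section ListColouring.
Variable C : finType.
Implicit Types (L : {set C}) (s : seq {set C}) (t : seq C).
Definition neq (T : eqType) : rel T := fun x y => x != y.

Lemma exists_colour_notin (a b : C) L : 2 < #|L| ->
  exists x, [/\ x \in L, x != a & x != b].
Proof.
move=> hL; have : 0 < #|L :\ a :\ b|.
  have := cardsD1 a L; have := cardsD1 b (L :\ a).
  by case: (_ \in _); case: (_ \in _); lia.
by case/card_gt0P=> x; rewrite !inE => /and3P[? ? ?]; exists x.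
Qed.

Lemma exists_colour_neq (a : C) L : 1 < #|L| -> exists2 x, x \in L & x != a.
Proof.
move=> hL; have : 0 < #|L :\ a|.
  by have := cardsD1 a L; case: (_ \in _); lia.
by case/card_gt0P=> x; rewrite !inE => /andP[? ?]; exists x.
Qed.

Lemma path_colouring_from (a : C) s : all (fun L => 1 < #|L|) s ->
  exists2 t, all2 (fun x L => x \in L) t s & path (@neq C) a t.
Proof.
elim: s a => [|L s IH] a /=; first by exists [::].
case/andP=> /(exists_colour_neq a)[x xL xa] /(IH x)[t ts xt].
by exists (x :: t) => /=; rewrite ?xL // /neq eq_sym xa.
Qed.

(** Colours spread outwards from the short list, or from the last list if none is short: a list with
    two colours can avoid the one neighbour already coloured. *)
Lemma path_colouring s :
    all (fun L => 0 < #|L|) s -> count (fun L => #|L| <= 1) s <= 1 ->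
  exists2 t, all2 (fun x L => x \in L) t s & sorted (@neq C) t.
Proof.
elim: s => [|L s IH] /=; first by exists [::].
case/andP=> L0 s0; case: (leqP #|L| 1) => [_ s1|L1 s1].
  have {}s1 : all (fun L => 1 < #|L|) s.
    rewrite -(eq_all (a1 := predC (fun L => #|L| <= 1))) => [|M /=].
      by rewrite all_predC has_count -leqNgt.
    by rewrite -ltnNge.
  case/card_gt0P: L0 => x xL; have [t ts xt] := path_colouring_from x s1.
  by exists (x :: t) => //=; rewrite xL.
have [[|y t] ts yt] := IH s0 s1.
  by case/card_gt0P: L0 => x xL; exists [:: x]; rewrite //= xL.
have [x xL xy] := exists_colour_neq y L1.
by exists [:: x, y & t]; rewrite /= ?xL // /neq xy.
Qed.

(** The list [L] is served last, since it must avoid the colours at both ends of the path. A lone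
    colour would be its own neighbour, hence the premise [0 < size s]. *)
Lemma cycle_colouring L s :
    2 < #|L| -> all (fun L => 0 < #|L|) s -> count (fun L => #|L| <= 1) s <= 1 ->
  exists2 t, all2 (fun x L => x \in L) t (L :: s) & 0 < size s -> path.cycle (@neq C) t.
Proof.
move=> L2 s0 /(path_colouring s0)[[|y t] ts yt].
  case/card_gt0P: (ltnW (ltnW L2)) => x xL.
  by exists [:: x]; rewrite /= ?xL //; case: s {s0} ts.
have [x [xL xy xt]] := exists_colour_notin y (last y t) L2.
exists [:: x, y & t]; first by rewrite /= xL.
by move=> _; rewrite /= rcons_path [path _ _ _]yt /neq xy /= eq_sym xt.
Qed.

End ListColouring.

(** * Averaging over the Hamiltonian cycles of a complete graph *)

Lemma perm_two_points (T : finType) (a b a' b' : T) : a != b -> a' != b' ->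
  exists2 s : {perm T}, s a = a' & s b = b'.
Proof.
(* The first transposition sends [a] to [a']; the second fixes [a'] and corrects the image of
   [b]. *)
move=> ab ab'; exists (tperm a a' * tperm (tperm a a' b) b')%g; rewrite permM.
  rewrite tpermL tpermD //; last by rewrite eq_sym.
  by rewrite -[X in _ != X](tpermL a a') (inj_eq perm_inj) eq_sym.
by rewrite tpermL.
Qed.

Lemma ordS_neq (n : nat) (i : 'I_n) : 1 < n -> i != ordS i.
Proof.
move=> n1; rewrite -val_eqE /=; have := ltn_ord i.
rewrite leq_eqVlt => /orP[/eqP iE|lt]; last by rewrite modn_small //; lia.
by rewrite iE modnn; lia.
Qed.

(** Under a uniform random permutation each pair [(i, ordS i)] is equidistributed over the ordered
    pairs of distinct points, so the mean cycle weight is the total weight divided by [n.-1]. *)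
Lemma exists_light_cycle (n : nat) (w : 'I_n -> 'I_n -> nat) :
    1 < n -> (forall i, w i i = 0) ->
  exists s : {perm 'I_n},
    n.-1 * \sum_i w (s i) (s (ordS i)) <= \sum_i \sum_j w i j.
Proof.
move=> n1 w0; set T := \sum_i _.
(* 2-transitivity: [S a b] does not depend on the pair [a != b]. *)
pose S a b := \sum_(s : {perm 'I_n}) w (s a) (s b).
have SE a b a' b' : a != b -> a' != b' -> S a b = S a' b'.
  move=> ab ab'; have [t ta tb] := perm_two_points ab ab'.
  rewrite /S (reindex_inj (mulgI t)).
  by apply: eq_bigr => s _; rewrite !permM ta tb.
have S0 a : S a a = 0 by rewrite /S big1.
pose a0 : 'I_n := Ordinal (ltnW n1); pose S1 := S a0 (ordS a0).
have a0S : a0 != ordS a0 by apply: ordS_neq.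
have sum_perm : \sum_(s : {perm 'I_n}) T = n`! * T.
  by rewrite sum_nat_const -card_Sn; congr (_ * _); apply: eq_card.
(* Double counting of [w (s a) (s b)] over [s], [a], [b]: each off-diagonal pair [(a, b)] gives
   [S1], and each [s] gives [T]. *)
have total : n * (n.-1 * S1) = n`! * T.
  transitivity (\sum_a \sum_b S a b).
    rewrite (eq_bigr (fun=> n.-1 * S1)) => [|a _].
      by rewrite sum_nat_const card_ord.
    rewrite (bigD1 a) //= S0 add0n.
    rewrite (eq_bigr (fun=> S1)) => [|b ba]; last by apply: SE; rewrite // eq_sym.
    by rewrite sum_nat_const cardC1 card_ord.
  rewrite -sum_perm.
  transitivity (\sum_(s : {perm 'I_n}) \sum_a \sum_b w (s a) (s b)).
    rewrite [RHS]exchange_big /=; apply: eq_bigr => a _.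
    by rewrite exchange_big.
  apply: eq_bigr => s _; rewrite /T [RHS](reindex_inj (@perm_inj _ s)) /=.
  by apply: eq_bigr => i _; rewrite [RHS](reindex_inj (@perm_inj _ s)).
have cyc : \sum_(s : {perm 'I_n}) \sum_i w (s i) (s (ordS i)) = n * S1.
  rewrite exchange_big /= (eq_bigr (fun=> S1)) => [|i _]; last by apply: SE; apply: ordS_neq.
  by rewrite sum_nat_const card_ord.
(* If every [s] failed, each would contribute at least [T.+1], which exceeds the mean given by
   [total] and [cyc]. *)
apply/existsP; apply: contraT; rewrite negb_exists => /forallP heavy.
suff : n`! * T < n`! * T by rewrite ltnn.
rewrite -{2}total mulnCA -cyc [ltnRHS]big_distrr -sum_perm /=.
apply: (@leq_trans (\sum_(s : {perm 'I_n}) T.+1)).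
  rewrite !sum_nat_const mulnS -[leqLHS]add1n leq_add2r.
  by apply/card_gt0P; exists 1%g.
by apply: leq_sum => s _; have := heavy s; rewrite -ltnNge.
Qed.

(** * Existence of a good 2-opt exchange *)

Lemma sum_ordS (m : nat) (h : nat -> nat -> nat) :
  \sum_(i < m.+1) h i (ordS i) = \sum_(0 <= i < m) h i i.+1 + h m 0.
Proof.
rewrite big_ord_recr /= modnn big_mkord; congr (_ + _).
by apply: eq_bigr => i _; rewrite modn_small //; have := ltn_ord i; lia.
Qed.

(** The closing pair and all the chords are distinct unordered pairs, so the double sum counts each
    of them twice. *)
Lemma sum_cross_le (m : nat) (f : nat -> nat -> nat) :
    0 < m -> (forall i j, f i j = f j i) ->
  2 * (f m 0 + \sum_(1 <= i < m.-1) (f 0 i.+1 + f m i))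
    <= \sum_(0 <= i < m.+1) \sum_(0 <= j < m.+1) f i j.
Proof.
case: m => // p _ fC; rewrite succnK.
have ends (g : nat -> nat) :
    \sum_(0 <= i < p.+2) g i = g 0 + (\sum_(1 <= i < p.+1) g i + g p.+1).
  by rewrite big_ltn // big_nat_recr.
rewrite ends !(ends (f _)).
(* The middle rows supply one copy of each chord, through the first and last columns; the first and
   last rows supply the other. *)
have middle : \sum_(1 <= i < p.+1) (f 0 i + f p.+1 i)
    <= \sum_(1 <= i < p.+1) \sum_(0 <= j < p.+2) f i j.
  by apply: leq_sum => i _; rewrite ends (fC 0) (fC p.+1); lia.
have row0 : \sum_(1 <= i < p) f 0 i.+1 <= \sum_(1 <= i < p.+1) f 0 i.
  case: p {ends middle} => [|p]; first by rewrite !big_geq.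
  by rewrite [leqRHS]big_ltn // [X in _ + X]big_add1 leq_addl.
have rowm : \sum_(1 <= i < p) f p.+1 i <= \sum_(1 <= i < p.+1) f p.+1 i.
  case: p {ends middle row0} => [|p]; first by rewrite !big_geq.
  by rewrite [leqRHS]big_nat_recr //= leq_addr.
rewrite big_split /= in middle; rewrite big_split /=.
have := fC 0 p.+1; lia.
Qed.

(** If all [m.-2] couples weighed at least [c], the double sum would be at least [2 * c * m.-1],
    which is not below [2 * (c.-1 * m)] when [c <= m]. *)
Lemma exists_light_crossing (m c : nat) (f : nat -> nat -> nat) :
    2 < m -> 0 < c <= m -> (forall i j, f i j = f j i) -> f m 0 = c ->
    \sum_(0 <= i < m.+1) \sum_(0 <= j < m.+1) f i j < 2 * (c.-1 * m) ->
  exists2 i, 1 <= i < m.-1 & f 0 i.+1 + f m i < c.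
Proof.
move=> m2 cm fC fc T.
have [[i _ /andP[im ic]]|none] :=
  @hasP _ (fun i => (1 <= i < m.-1) && (f 0 i.+1 + f m i < c)) (index_iota 1 m.-1).
  by exists i.
suff : (m.-2) * c <= \sum_(1 <= i < m.-1) (f 0 i.+1 + f m i).
  have := sum_cross_le (ltnW (ltnW m2)) fC; nia.
rewrite (_ : m.-2 = m.-1 - 1); last by lia.
rewrite -sum_nat_const_nat big_nat [leqRHS]big_nat; apply: leq_sum => i im.
rewrite leqNgt; apply/negP => ic; apply: none; exists i; last by rewrite im.
by rewrite mem_index_iota.
Qed.

(* 2-opt move: the edges [(i, i+1)] and [(m, 0)] of the cycle [0, 1, ..., m]
   are replaced by [(i, m)] and [(i+1, 0)]. *)
Definition two_opt (m i j : nat) : nat := if j <= i then j else m.+1 + i - j.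

(** Stated without subtraction: the removed edge [(i, i.+1)] is added back on the left, and the
    removed edge [(m, 0)] is left out on the right. *)
Lemma sum_two_opt (m i : nat) (f : nat -> nat -> nat) :
    i < m -> (forall a b, f a b = f b a) ->
  \sum_(0 <= j < m) f (two_opt m i j) (two_opt m i j.+1)
    + f (two_opt m i m) (two_opt m i 0) + f i i.+1
  = \sum_(0 <= j < m) f j j.+1 + (f 0 i.+1 + f m i).
Proof.
move=> im fC; rewrite /two_opt (leqNgt m i) im /= addnAC.
rewrite (_ : m.+1 + i - m = i.+1) ?(fC i.+1 0); last by lia.
rewrite addnC addnA !(@big_cat_nat _ _ _ i.+1 0 m) //= !big_nat_recr //=.
rewrite leqnn ltnn (_ : m.+1 + i - i.+1 = m); last by lia.
have -> : \sum_(0 <= j < i) f (if j <= i then j else m.+1 + i - j)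
        (if j < i then j.+1 else m.+1 + i - j.+1) = \sum_(0 <= j < i) f j j.+1.
  by apply: eq_big_nat => j /andP[_ ji]; rewrite ji ltnW.
(* The segment from [i.+1] to [m] is traversed backwards, so its old sum is reindexed in reverse. *)
rewrite [X in _ = _ + X + _]big_nat_rev /=.
have -> : \sum_(i.+1 <= j < m) f (if j <= i then j else m.+1 + i - j)
        (if j < i then j.+1 else m.+1 + i - j.+1)
      = \sum_(i.+1 <= j < m) f (i.+1 + m - j.+1) (i.+1 + m - j.+1).+1.
  apply: eq_big_nat => j /andP[ij jm].
  rewrite (leqNgt j i) ij ltnNge (ltnW ij) /= fC; congr f; lia.
rewrite (fC i m); lia.
Qed.

Lemma exists_light_two_opt (m c : nat) (w : 'I_m.+1 -> 'I_m.+1 -> nat) :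
    2 < m -> 2 < c <= m -> (forall i j, w i j = w j i) -> w ord_max ord0 = c ->
    \sum_i w i (ordS i) < 2 * c.-1 -> \sum_i \sum_j w i j < 2 * (c.-1 * m) ->
  exists u : 'I_m.+1 -> 'I_m.+1, [/\ injective u,
    forall i, w (u i) (u (ordS i)) < c & \sum_i w (u i) (u (ordS i)) < 2 * c.-1].
Proof.
move=> m2 cm wC wc W T.
pose f i j := w (inord i) (inord j).
have fC i j : f i j = f j i by exact: wC.
have wE i j : w i j = f i j by rewrite /f !inord_val.
have fc : f m 0 = c by rewrite -wc wE.
have c_bounds : 0 < c <= m by lia.
have [|i im fi] := exists_light_crossing m2 c_bounds fC fc.
  rewrite big_mkord; under eq_bigr do rewrite big_mkord.
  by under eq_bigr do under eq_bigr do rewrite -wE.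
have im' : i < m by lia.
(* The closing edge takes [c] of a weight below [2 * c.-1]. The remaining path is so light that the
   new chords, together below [c], keep the total under the bound. *)
have light : \sum_(0 <= j < m) f j j.+1 < c.-2.
  move: W; under eq_bigr do rewrite wE.
  by rewrite sum_ordS fc; lia.
have edge j : j < m -> f j j.+1 < c.-2.
  move=> jm; apply: leq_ltn_trans light.
  by rewrite (big_cat_nat (n := j)) ?(ltnW jm) //= [X in _ + X]big_ltn //; lia.
have bound j : j < m.+1 -> two_opt m i j < m.+1 by rewrite /two_opt; case: (leqP j i); lia.
pose u (j : 'I_m.+1) : 'I_m.+1 := Ordinal (bound j (ltn_ord j)).
have uE a b : w (u a) (u b) = f (two_opt m i a) (two_opt m i b) by rewrite wE.
exists u; split.
- move=> a b /(congr1 val) /= ab; apply: val_inj => /=; move: ab (ltn_ord a) (ltn_ord b).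
  by rewrite /two_opt; case: (leqP a i); case: (leqP b i); lia.
- move=> j; rewrite uE /= /two_opt.
  have [jm|jm] := ltnP j m; last first.
    have -> : nat_of_ord j = m by have := ltn_ord j; lia.
    rewrite modnn (leqNgt m i) im' /= (_ : m.+1 + i - m = i.+1); last by lia.
    by rewrite fC; lia.
  (* In order: an old edge, an old edge reversed, and the chord [(i, m)]. *)
  rewrite modn_small //; case: (ltngtP j i) => ji.
  + by have := edge j jm; lia.
  + rewrite fC (_ : m.+1 + i - j = (m + i - j).+1); last by lia.
    rewrite (_ : m.+1 + i - j.+1 = m + i - j); last by lia.
    by have := @edge (m + i - j); lia.
  + by rewrite ji (_ : m.+1 + i - i.+1 = m) ?(fC i); lia.
under eq_bigr do rewrite uE.
rewrite (sum_ordS m (fun a b => f (two_opt m i a) (two_opt m i b))).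
have := sum_two_opt im' fC; lia.
Qed.

(** * Cyclic list colouring indexed by ordinals *)

Section Rotation.
Variables (m t : nat).
Definition rotate_ord (j : 'I_m.+1) : 'I_m.+1 := inZp (j + t).

Lemma rotate_ordS j : rotate_ord (ordS j) = ordS (rotate_ord j).
Proof. by apply: val_inj; rewrite /= modnDml -[in RHS]addn1 modnDml addn1. Qed.

Lemma rotate_ord_inj : injective rotate_ord.
Proof.
move=> i j /(congr1 val) /= /eqP; rewrite eqn_modDr !modn_small // => /eqP ij.
exact: val_inj.
Qed.

End Rotation.

Lemma cyclic_colouring_ord0 (C : finType) (m : nat) (L : 'I_m.+1 -> {set C}) :
    0 < m -> 2 < #|L ord0| -> (forall i, 0 < #|L i|) ->
    (forall i j, #|L i| <= 1 -> #|L j| <= 1 -> i = j) ->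
  exists k : 'I_m.+1 -> C, forall i, k i \in L i /\ k i != k (ordS i).
Proof.
move=> m0 L2 L0 L1; pose s := [seq L (lift ord0 j) | j <- enum 'I_m].
have [|||] := @cycle_colouring _ (L ord0) s.
- by [].
- by apply/allP=> _ /mapP[j _ ->].
- rewrite count_map -sum1_count big_enum_cond sum1_card.
  apply/card_le1_eqP => i j; rewrite 2!unfold_in => Li Lj.
  by apply: (@lift_inj _ ord0); apply: L1.
case=> // x t; rewrite size_map size_enum_ord => /[swap] /(_ m0) /(pathP x) xt.
have -> : L ord0 :: s = [seq L i | i <- enum 'I_m.+1].
  by rewrite enum_ordSl /= -map_comp.
rewrite all2E size_map size_enum_ord => /andP[/eqP sz /all_nthP ts].
have [szt] := sz.
exists (fun i : 'I_m.+1 => nth x (x :: t) i) => i; split.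
  have := ts (x, L ord0) i.
  rewrite size_zip size_map size_enum_ord sz minnn ltn_ord => /(_ isT).
  rewrite nth_zip /=; last by rewrite size_map size_enum_ord szt.
  by rewrite (nth_map ord0) ?size_enum_ord // nth_ord_enum.
(* [path.cycle] appends the head [x] to [t]; at [i = m] this appended entry is the colour at
   [ordS i = ord0]. *)
have := xt i; rewrite size_rcons szt ltn_ord => /(_ isT).
rewrite -rcons_cons nth_rcons sz ltn_ord nth_rcons szt /neq /=.
have [im|im] := ltnP i m; first by rewrite modn_small.
have -> : nat_of_ord i = m by have := ltn_ord i; lia.
by rewrite eqxx modnn.
Qed.

Lemma cyclic_colouring (C : finType) (m : nat) (L : 'I_m.+1 -> {set C}) p :
    0 < m -> 2 < #|L p| -> (forall i, 0 < #|L i|) ->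
    (forall i j, #|L i| <= 1 -> #|L j| <= 1 -> i = j) ->
  exists k : 'I_m.+1 -> C, forall i, k i \in L i /\ k i != k (ordS i).
Proof.
move=> m0 L2 L0 L1; have rI := @rotate_ord_inj m p.
have [|||k kL] := @cyclic_colouring_ord0 _ _ (L \o rotate_ord p) m0.
- rewrite /= (_ : rotate_ord p ord0 = p) //.
  by apply: val_inj; rewrite /= add0n modn_small.
- by move=> i; apply: L0.
- by move=> i j Li Lj; apply/rI/L1.
have [g gK Kg] := injF_bij rI.
exists (k \o g) => i /=; have [] := kL (g i); rewrite /= Kg; split=> //.
by rewrite -[i in g (ordS i)]Kg -rotate_ordS gK.
Qed.

(** * A light cycle without an empty pair *)

Lemma exists_colourable_cycle (m c : nat) (w : 'I_m.+1 -> 'I_m.+1 -> nat) :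
    2 < m -> 2 < c <= m -> (forall i j, w i j = w j i) -> (forall i, w i i = 0) ->
    (forall i j, w i j <= c) -> \sum_i \sum_j w i j < 2 * (c.-1 * m) ->
  exists u : 'I_m.+1 -> 'I_m.+1, [/\ injective u,
    forall i, w (u i) (u (ordS i)) < c & \sum_i w (u i) (u (ordS i)) < 2 * c.-1].
Proof.
move=> m2 cm wC w0 wc T.
have [s Ws] : exists s : {perm 'I_m.+1},
    \sum_i w (s i) (s (ordS i)) < 2 * c.-1.
  have [|//|s Ws] := exists_light_cycle (w := w); first by lia.
  by exists s; move: Ws; rewrite succnK; nia.
have [/forallP ws|] := boolP [forall i, w (s i) (s (ordS i)) < c].
  by exists s; split=> //; apply: perm_inj.
rewrite negb_forall => /existsP[i0 wi0].
(* Rotating by [i0.+1] turns the empty pair at [i0] into the closing pair [(ord_max, ord0)]. *)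
pose v j := s (rotate_ord i0.+1 j).
have vI : injective v by move=> a b /perm_inj /rotate_ord_inj.
have [||||u [uI uc Wu]] := @exists_light_two_opt m c (fun i j => w (v i) (v j)) m2 cm.
- by move=> i j; apply: wC.
- rewrite /v (_ : ord0 = ordS ord_max) ?rotate_ordS; last first.
    by apply: val_inj; rewrite /= modnn.
  rewrite (_ : rotate_ord i0.+1 ord_max = i0).
    by apply/eqP; rewrite eqn_leq wc /= leqNgt.
  by apply: val_inj; rewrite /= addnS -addSn modnDl modn_small.
- move: Ws; rewrite (reindex_inj (@rotate_ord_inj m i0.+1)).
  by under eq_bigr do rewrite -rotate_ordS.
- move: T; rewrite (reindex_inj vI).
  by under eq_bigr do rewrite (reindex_inj vI).
by exists (v \o u); split=> //; apply: inj_comp.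
Qed.

(** * Missing colours of a multigraph *)

Section MissingColours.
Variables (V : finType) (c : nat) (G : ecmultigraph V c).

Definition colours (x y : V) : {set 'I_c} := [set k | ([set x; y], k) \in edges G].
(** The factor [x != y] clears the diagonal, where the value would otherwise be [c]: the singleton
    [[set x; x]] carries no edge. *)
Definition missing (x y : V) : nat := (x != y) * #|~: colours x y|.

Lemma missingC x y : missing x y = missing y x.
Proof. by rewrite /missing /colours eq_sym setUC. Qed.

Lemma missing_neq x y : x != y -> #|colours x y| + missing x y = c.
Proof. by rewrite /missing => ->; rewrite mul1n cardsC card_ord. Qed.

Lemma missing_le x y : missing x y <= c.
Proof.
have [->|/missing_neq] := eqVneq x y; last by lia.
by rewrite /missing eqxx mul0n.
Qed.

(** Each edge has two orderings of its ends, and the edges over a given ordered pair are determined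
    by their colours. *)
Lemma double_edges_le :
  2 * #|edges G| <= \sum_x \sum_(y | y != x) #|colours x y|.
Proof.
rewrite pair_big_dep /=.
have fibre (p : V * V) : \sum_(e in edges G) (e.1 == [set p.1; p.2]) <= #|colours p.1 p.2|.
  rewrite -big_mkcondr sum1_card.
  apply: leq_trans (leq_imset_card (fun k => ([set p.1; p.2], k)) _).
  apply: subset_leq_card; apply/subsetP => -[a k]; rewrite unfold_in /= => /andP[ak /eqP ap].
  by apply/imsetP; exists k; rewrite -?ap // /colours in_set -ap.
apply: (@leq_trans (\sum_(p : V * V | p.2 != p.1)
    \sum_(e in edges G) (e.1 == [set p.1; p.2]))); last exact: leq_sum.
rewrite exchange_big /=.
rewrite mulnC -sum_nat_const; apply: leq_sum => -[a k] /card_edge_ends /= /eqP.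
move/cards2P=> [x [y [xy ->]]].
have yx : (y, x) != (x, y) by rewrite xpair_eqE negb_and xy orbT.
rewrite (bigD1 (x, y)) /= 1?eq_sym // eqxx (bigD1 (y, x)) /= ?xy //.
by rewrite setUC eqxx; lia.
Qed.

Lemma sum_missing :
  \sum_x \sum_y missing x y + 2 * #|edges G| <= c * (#|V| * #|V|.-1).
Proof.
rewrite (leq_trans (leq_add (leqnn _) double_edges_le)) //.
rewrite -big_split /= mulnC -mulnA -sum_nat_const; apply: leq_sum => x _.
rewrite (bigD1 x) //= {1}/missing eqxx mul0n add0n -big_split /=.
rewrite (eq_bigr (fun=> c)) => [|y yx]; last by rewrite addnC missing_neq // eq_sym.
by rewrite sum_nat_const cardC1.
Qed.

Lemma hamiltonian_of_light_cycle (m : nat) (v : 'I_m.+1 -> V) :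
    2 < m -> 2 < c -> #|V| = m.+1 -> injective v ->
    (forall i, missing (v i) (v (ordS i)) < c) ->
    \sum_i missing (v i) (v (ordS i)) < 2 * c.-1 ->
  has_proper_hamiltonian_cycle G.
Proof.
move=> m2 c2 Vm vI vc W.
have vS i : #|colours (v i) (v (ordS i))| + missing (v i) (v (ordS i)) = c.
  by apply: missing_neq; rewrite (inj_eq vI) ordS_neq ?ltnS ?(ltnW (ltnW m2)).
(* Otherwise each of the at least four pairs misses [c.-2] colours or more, and
   [4 * c.-2 >= 2 * c.-1] since [c >= 3]. *)
have [p Lp] : exists p, 2 < #|colours (v p) (v (ordS p))|.
  apply/existsP; apply: contraT; rewrite negb_exists => /forallP few.
  have : \sum_(i < m.+1) c.-2 <= \sum_i missing (v i) (v (ordS i)).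
    by apply: leq_sum => i _; have := few i; have := vS i; lia.
  by rewrite sum_nat_const card_ord; nia.
have [||||k kL] := @cyclic_colouring _ m (fun i => colours (v i) (v (ordS i))) p.
- by lia.
- by [].
- by move=> i; have := vS i; have := vc i; lia.
(* Two distinct pairs with at most one colour each would already miss [2 * c.-1] colours. *)
- move=> i j Li Lj; apply/eqP; apply: contraT => ij.
  move: W; rewrite (bigD1 i) //= (bigD1 j) //= 1?eq_sym //.
  by have := vS i; have := vS j; lia.
have [g gK Kg] : bijective v by apply: inj_card_bij; rewrite // card_ord Vm.
exists m.+1, v, k; split; last by move=> x; exists (g x).
split=> // [|i|i]; first by lia.
  by have [] := kL i; rewrite in_set.
by have [] := kL i.
Qed.

End MissingColours.

Theorem theorem5 (V : finType) (n m c : nat) (G : ecmultigraph V c)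
    (card_V : #|V| = n) (card_edges : #|edges G| = m)
    (G_connected : connected G)
    (n_ge4 : 4 <= n) (c_ge3 : 3 <= c) (c_lt_n : c < n)
    (m_ge : c * 'C(n.-1, 2) + n <= m) :
  has_proper_hamiltonian_cycle G.
Proof.
case: n => [//|p] in card_V n_ge4 c_lt_n m_ge *.
have [b bI] : exists b : 'I_p.+1 -> V, bijective b.
  rewrite -card_V; exists enum_val; exact: enum_val_bij.
pose w i j := missing G (b i) (b j).
(* With [n = p.+1], the ordered pairs miss at most [c * n * p - 2 * m] colours. The edge bound makes
   this at most [2 * (c * p - n)], which is [2] less than the right-hand side. *)
have W : \sum_i \sum_j w i j < 2 * (c.-1 * p).
  have -> : \sum_i \sum_j w i j = \sum_x \sum_y missing G x y.
    rewrite [RHS](reindex b) /=; last exact: onW_bij.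
    by apply: eq_bigr => i _; rewrite [RHS](reindex b) //; apply: onW_bij.
  have := sum_missing G; rewrite card_edges card_V succnK.
  have := mul_bin_diag p 1; rewrite bin1 => pp.
  case: p => // q in card_V n_ge4 c_lt_n m_ge b bI w pp *.
  move: (\sum_x _) pp m_ge => S /= /(congr1 (muln c)).
  move: c.-1 (prednK (ltnW (ltnW c_ge3))) => d <-; nia.
have [||||||u [uI uc Wu]] := @exists_colourable_cycle p c w.
- by lia.
- by lia.
- by move=> i j; apply: missingC.
- by move=> i; rewrite /w /missing eqxx mul0n.
- by move=> i j; apply: missing_le.
- exact: W.
apply: (@hamiltonian_of_light_cycle _ _ _ p (b \o u)) => //.
exact: inj_comp (bij_inj bI) uI.
Qed.
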